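(* Let $\Omega\subset\mathbb{O}\cong\mathbb{R}^8$ be open and let $f\colon\Omega\to\mathbb{O}$ be componentwise differentiable, written as \[ f=f_1+f_2e_2+(f_3+f_4e_2)e_4 \] with functions $f_1,f_2,f_3,f_4\colon\Omega\to\mathbb{C}$, where $\mathbb{C}=\operatorname{span}_{\mathbb{R}}\{1,e_1\}\subset\mathbb{O}$. Then $\partial_xf=0$ in $\Omega$ if and only if the following complex $4\times4$ system holds in $\Omega$: \[ \begin{cases} \partial_{z_1}f_1-\partial_{z_2}\overline{f}_2-\partial_{z_3}\overline{f}_3-\partial_{\overline{z}_4}f_4=0\\ \partial_{z_1}f_2+\partial_{z_2}\overline{f}_1+\partial_{\overline{z}_3}f_4-\partial_{z_4}\overline{f}_3=0\\ \partial_{z_1}f_3-\partial_{\overline{z}_2}f_4+\partial_{z_3}\overline{f}_1+\partial_{z_4}\overline{f}_2=0\\ \partial_{\overline{z}_1}f_4+\partial_{z_2}f_3-\partial_{z_3}f_2+\partial_{z_4}f_1=0 \end{cases} \]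
   Context: Let $\mathbb{H}$ be the quaternions with basis $\{1,i,j,k\}$, $i^2=j^2=k^2=ijk=-1$, and conjugation $a\mapsto\overline{a}$. The octonions $\mathbb{O}$ are $\mathbb{H}\oplus\mathbb{H}$ with the multiplication $(a,b)(c,d)=(ac-\overline{d}b,\ da+b\overline{c})$. A real basis of $\mathbb{O}$ is $e_0=1=(1,0)$, $e_1=(i,0)$, $e_2=(j,0)$, $e_3=(k,0)$, $e_4=(0,1)$, $e_5=(0,i)$, $e_6=(0,j)$, $e_7=(0,k)$. A point $x=\sum_{j=0}^7x_je_j\in\mathbb{O}$ is identified with $(x_0,\ldots,x_7)\in\mathbb{R}^8$ and is written $x=z_1+z_2e_2+(z_3+z_4e_2)e_4$ with $z_1=x_0+x_1e_1$, $z_2=x_2+x_3e_1$, $z_3=x_4+x_5e_1$, $z_4=x_6+x_7e_1$ in $\mathbb{C}=\operatorname{span}_{\mathbb{R}}\{1,e_1\}$. The complex Cauchy-Riemann operators are (without factors $1/2$) $\partial_{z_1}=\partial_{x_0}+e_1\partial_{x_1}$, $\partial_{z_2}=\partial_{x_2}+e_1\partial_{x_3}$, $\partial_{z_3}=\partial_{x_4}+e_1\partial_{x_5}$, $\partial_{z_4}=\partial_{x_6}+e_1\partial_{x_7}$, and $\partial_{\overline{z}_j}$ denotes the operator obtained from $\partial_{z_j}$ by replacing $e_1$ with $-e_1$. The bar on $f_j$ is complex conjugation in $\operatorname{span}_{\mathbb{R}}\{1,e_1\}$. The octonionic Cauchy-Riemann operator $\partial_x=\sum_{i=0}^7e_i\partial_{x_i}$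 acts from the left on $f=\sum_jF_je_j$ ($F_j$ real-valued) by $\partial_xf=\sum_{i,j=0}^7e_ie_j\,\partial_{x_i}F_j$. *)

(* Defs.v *)
From HB Require Import structures.
From mathcomp Require Import all_boot all_order all_algebra.
From mathcomp Require Import complex.
From mathcomp Require Import all_classical all_reals all_analysis.
Set Implicit Arguments.
Unset Strict Implicit.
Unset Printing Implicit Defensive.
Import Order.TTheory GRing.Theory Num.Theory.
Import numFieldNormedType.Exports.
Local Open Scope ring_scope.

(* Quaternions are row vectors of coordinates in the basis 1, i, j, k. *)
Notation quat R := 'rV[R]_4.

Definition mkquat (R : realType) (a b c d : R) : quat R :=
  \row_(n < 4) [:: a; b; c; d]`_n.

(* Hamilton's product: i^2 = j^2 = k^2 = ijk = -1, extended bilinearly;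
   see quat_relations. *)
Definition qmul (R : realType) (p q : quat R) : quat R :=
  let a := p 0 0 in let b := p 0 1 in let c := p 0 2 in let d := p 0 3 in
  let a' := q 0 0 in let b' := q 0 1 in let c' := q 0 2 in let d' := q 0 3 in
  mkquat (a * a' - b * b' - c * c' - d * d')
         (a * b' + b * a' + c * d' - d * c')
         (a * c' - b * d' + c * a' + d * b')
         (a * d' + b * c' - c * b' + d * a').

Definition qconj (R : realType) (p : quat R) : quat R :=
  mkquat (p 0 0) (- p 0 1) (- p 0 2) (- p 0 3).

Lemma quat_relations (R : realType) :
  let one := mkquat 1 0 0 0 : quat R in
  let i := mkquat 0 1 0 0 : quat R in
  let j := mkquat 0 0 1 0 : quat R in
  let k := mkquat 0 0 0 1 : quat R in
  [/\ forall p : quat R, qmul one p = p /\ qmul p one = p,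
      qmul i i = - one, qmul j j = - one, qmul k k = - one
    & qmul (qmul i j) k = - one].
Proof.
split; [move=> p; split | ..]; apply/rowP => -[[|[|[|[|//]]]] lt4];
  rewrite /qmul !mxE /= ?(mul0r, mulr0, mul1r, mulr1, addr0, add0r,
    subr0, sub0r, oppr0, mulrN, mulNr, opprK) //;
  by congr (p 0 _); apply: val_inj.
Qed.

(* The octonions are identified with R^8 = R^4 (+) R^4, as a set, a real normed
   space (for the library's norm on row vectors, equivalent to the Euclidean
   one) and a domain of differentiation. The pair (a, b) of quaternions is
   row_mx a b, so that the basis e_0, ..., e_7 is the canonical one. *)
Notation oct R := 'rV[R]_8.

Definition octpair (R : realType) (a b : quat R) : oct R :=
  @row_mx R 1 4 4 a b.
Definition oct1 (R : realType) (x : oct R) : quat R := @lsubmx R 1 4 4 x.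
Definition oct2 (R : realType) (x : oct R) : quat R := @rsubmx R 1 4 4 x.

(* (a, b)(c, d) = (ac - conj(d) b, da + b conj(c)) *)
Definition omul (R : realType) (x y : oct R) : oct R :=
  let a := oct1 x in let b := oct2 x in
  let c := oct1 y in let d := oct2 y in
  octpair (qmul a c - qmul (qconj d) b) (qmul d a + qmul b (qconj c)).

Definition e {R : realType} (n : 'I_8) : oct R := delta_mx 0 n.

Section Operators.
Variable R : realType.

(* All functions are total: the values of g outside of an open set do not
   affect its derivatives at the points of that set. *)
Definition partial (n : 'I_8) (g : oct R -> R) (x : oct R) : R :=
  'D_(e n) g x.

Definition octCR (f : oct R -> oct R) (x : oct R) : oct R :=
  \sum_(i < 8) \sum_(j < 8)
    partial i (fun y => f y 0 j) x *: omul (e i) (e j).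

(* R[i] is identified with span {1, e_1} inside the octonions. *)
Definition octC (z : R[i]) : oct R :=
  complex.Re z *: e 0 + complex.Im z *: e 1.

Definition partialC (n : 'I_8) (g : oct R -> R[i]) (x : oct R) : R[i] :=
  Complex (partial n (fun y => complex.Re (g y)) x)
          (partial n (fun y => complex.Im (g y)) x).

(* The Cauchy-Riemann operators d/dx_m + i d/dx_n and d/dx_m - i d/dx_n
   (without the factor 1/2) for the complex variable x_m + i x_n. Beware that
   the former, which is usually d/d(conj z), is the one denoted d/dz here. *)
Definition dplus (m n : 'I_8) (g : oct R -> R[i]) (x : oct R) : R[i] :=
  partialC m g x + 'i%C * partialC n g x.
Definition dminus (m n : 'I_8) (g : oct R -> R[i]) (x : oct R) : R[i] :=
  partialC m g x - 'i%C * partialC n g x.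

Definition dz1 := dplus 0 1.
Definition dz2 := dplus 2 3.
Definition dz3 := dplus 4 5.
Definition dz4 := dplus 6 7.
Definition dzbar1 := dminus 0 1.
Definition dzbar2 := dminus 2 3.
Definition dzbar3 := dminus 4 5.
Definition dzbar4 := dminus 6 7.

Definition conjf (g : oct R -> R[i]) (x : oct R) : R[i] := (conjc (g x)).

End Operators.

(* Main.v *)
Require Import Defs.
From HB Require Import structures.
From mathcomp Require Import all_boot all_order all_algebra.
From mathcomp Require Import complex ring.
From mathcomp Require Import all_classical all_reals all_analysis.
Set Implicit Arguments.
Unset Strict Implicit.
Unset Printing Implicit Defensive.
Import Order.TTheory GRing.Theory Num.Theory.
Import numFieldNormedType.Exports.
Local Open Scope ring_scope.

(** Written in the complex coordinates of x = z1 + z2 e_2 + (z3 + z4 e_2) e_4,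
    the product of two octonions is
      (a1, a2, a3, a4) (b1, b2, b3, b4) =
        (a1 b1 - a2 b2^* - a3 b3^* - a4^* b4,
         a1 b2 + a2 b1^* + a3^* b4 - a4 b3^*,
         a1 b3 - a2^* b4 + a3 b1^* + a4 b2^*,
         a1^* b4 + a2 b3 - a3 b2 + a4 b1)
    (omul_coct). The complex system is this table with the operator d/dz_m in
    the place of a_m, d/d(conj z_m) in the place of a_m^*, and the function f_k
    in the place of b_k.

    The substitution is legitimate because octCR f is the sum over i of e_i
    times the i-th partial derivative of f (octCR_omul), and every e_i has one
    nonzero complex coordinate, 1 or the imaginary unit. Hence in the m-th slot
    the real derivatives along x_(2m-2) and x_(2m-1) combine into
    d/dx_(2m-2) + i d/dx_(2m-1), with the sign of i reversed where the table
    conjugates a_m (sum_omul_e). Two analytic facts remain. The real coordinates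
    of f agree with the real and imaginary parts of the f_k on an open set,
    therefore have the same derivatives there; and a real partial derivative
    commutes with complex conjugation (partialC_conjf). An octonion vanishes if
    and only if its four complex coordinates do, which yields the
    equivalence. *)

(** * Octonions in complex coordinates *)

Section ComplexCoordinates.
Variable R : realType.
Implicit Types (z w : R[i]) (p q : quat R) (x y : oct R).

(** The quaternion z + w j, with C identified with the span of 1 and i. *)
Definition cquat z w : quat R :=
  mkquat (complex.Re z) (complex.Im z) (complex.Re w) (complex.Im w).

(** The octonion z1 + z2 e_2 + (z3 + z4 e_2) e_4; see octC_decomposition. *)
Definition coct z1 z2 z3 z4 : oct R := octpair (cquat z1 z2) (cquat z3 z4).

Lemma cquatD z w z' w' : cquat z w + cquat z' w' = cquat (z + z') (w + w').
Proof.
case: z z' w w' => [a b] [a' b'] [c d] [c' d'].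
by apply/rowP => -[[|[|[|[|//]]]] lt4]; rewrite !mxE.
Qed.

Lemma cquatN z w : - cquat z w = cquat (- z) (- w).
Proof.
case: z w => [a b] [c d].
by apply/rowP => -[[|[|[|[|//]]]] lt4]; rewrite !mxE.
Qed.

Lemma qconj_cquat z w : qconj (cquat z w) = cquat (conjc z) (- w).
Proof.
case: z w => [a b] [c d].
by apply/rowP => -[[|[|[|[|//]]]] lt4]; rewrite !mxE.
Qed.

(** In complex coordinates Hamilton's product is governed by the single rule
    j z = z^* j. *)
Lemma qmul_cquat z w z' w' :
  qmul (cquat z w) (cquat z' w')
  = cquat (z * z' - w * conjc w') (z * w' + w * conjc z').
Proof.
case: z z' w w' => [a b] [a' b'] [c d] [c' d'].
by apply/rowP => -[[|[|[|[|//]]]] lt4]; rewrite !mxE /=; ring.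
Qed.

Lemma omul_octpair (a b c d : quat R) :
  omul (octpair a b) (octpair c d)
  = octpair (qmul a c - qmul (qconj d) b) (qmul d a + qmul b (qconj c)).
Proof. by rewrite /omul /oct1 /oct2 /octpair !row_mxKl !row_mxKr. Qed.

(** The Cayley-Dickson product, with each of its four quaternion products
    expanded by qmul_cquat. *)
Lemma omul_coct a1 a2 a3 a4 b1 b2 b3 b4 :
  omul (coct a1 a2 a3 a4) (coct b1 b2 b3 b4) =
  coct (a1 * b1 - a2 * conjc b2 - a3 * conjc b3 - conjc a4 * b4)
       (a1 * b2 + a2 * conjc b1 + conjc a3 * b4 - a4 * conjc b3)
       (a1 * b3 - conjc a2 * b4 + a3 * conjc b1 + a4 * conjc b2)
       (conjc a1 * b4 + a2 * b3 - a3 * b2 + a4 * b1).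
Proof.
rewrite omul_octpair !qconj_cquat !qmul_cquat cquatN !cquatD /coct.
by congr (octpair (cquat _ _) (cquat _ _)); rewrite ?rmorphN ?conjcK /=; ring.
Qed.

Lemma coctD a1 a2 a3 a4 b1 b2 b3 b4 :
  coct a1 a2 a3 a4 + coct b1 b2 b3 b4
  = coct (a1 + b1) (a2 + b2) (a3 + b3) (a4 + b4).
Proof. by rewrite /coct /octpair (@add_row_mx R 1 4 4) !cquatD. Qed.

Lemma coctE z1 z2 z3 z4 :
  coct z1 z2 z3 z4 =
  \row_n [:: complex.Re z1; complex.Im z1; complex.Re z2; complex.Im z2;
             complex.Re z3; complex.Im z3; complex.Re z4; complex.Im z4]`_n.
Proof.
rewrite -[RHS](@hsubmxK R 1 4 4) /coct /octpair.
by apply: (congr2 (@row_mx R 1 4 4)); apply/rowP => -[[|[|[|[|//]]]] lt4]; rewrite !mxE.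
Qed.

Lemma coct_eq0 z1 z2 z3 z4 :
  coct z1 z2 z3 z4 = 0 <-> [/\ z1 = 0, z2 = 0, z3 = 0 & z4 = 0].
Proof.
split=> [|[-> -> -> ->]]; last first.
  rewrite coctE.
  by apply/rowP => -[[|[|[|[|[|[|[|[|//]]]]]]]] lt8]; rewrite !mxE.
case: z1 z2 z3 z4 => [a0 a1] [a2 a3] [a4 a5] [a6 a7].
rewrite coctE => /rowP z0.
have := (z0 0, z0 1, (z0 2, z0 3), (z0 4, z0 5, (z0 6, z0 7))).
by rewrite !mxE /= => -[[[-> ->] [-> ->]] [[-> ->] [-> ->]]].
Qed.

(** The real basis consists of the complex coordinate units and their multiples
    by the imaginary unit. *)
Lemma e_coct :
  [/\ e 0 = coct 1 0 0 0 /\ e 1 = coct 'i%C 0 0 0,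
      e 2 = coct 0 1 0 0 /\ e 3 = coct 0 'i%C 0 0,
      e 4 = coct 0 0 1 0 /\ e 5 = coct 0 0 'i%C 0
    & e 6 = coct 0 0 0 1 /\ e 7 = coct 0 0 0 'i%C].
Proof.
split; split; rewrite coctE;
  by apply/rowP => -[[|[|[|[|[|[|[|[|//]]]]]]]] lt8]; rewrite !mxE.
Qed.

Lemma octC_coct z : octC z = coct z 0 0 0.
Proof.
rewrite coctE.
by apply/rowP => -[[|[|[|[|[|[|[|[|//]]]]]]]] lt8];
   rewrite !mxE /= ?mulr1 ?mulr0 ?addr0 ?add0r.
Qed.

Lemma octC_decomposition z1 z2 z3 z4 :
  octC z1 + omul (octC z2) (e 2)
  + omul (octC z3 + omul (octC z4) (e 2)) (e 4) = coct z1 z2 z3 z4.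
Proof.
have [_ [-> _] [-> _] _] := e_coct.
rewrite !octC_coct !(omul_coct, coctD) !(rmorph0, rmorph1).
by congr coct; rewrite ?rmorph0; ring.
Qed.

(** * The Cauchy-Riemann operator as a sum of products *)

Lemma qmulDZr p a q q' : qmul p (a *: q + q') = a *: qmul p q + qmul p q'.
Proof.
by apply/rowP => -[[|[|[|[|//]]]] lt4]; rewrite !mxE /=; ring.
Qed.

Lemma qmulDZl p a q q' : qmul (a *: q + q') p = a *: qmul q p + qmul q' p.
Proof.
by apply/rowP => -[[|[|[|[|//]]]] lt4]; rewrite !mxE /=; ring.
Qed.

Lemma qconjDZ a q q' : qconj (a *: q + q') = a *: qconj q + qconj q'.
Proof.
by apply/rowP => -[[|[|[|[|//]]]] lt4]; rewrite !mxE /=; ring.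
Qed.

Lemma omul_linear x : linear (omul x).
Proof.
move=> a y y'; rewrite /omul /octpair /oct1 /oct2 !linearP /=.
rewrite qconjDZ !qmulDZr !qconjDZ !qmulDZl qmulDZr.
rewrite (@scale_row_mx R 1 4 4) (@add_row_mx R 1 4 4).
by apply: (congr2 (@row_mx R 1 4 4)); rewrite ?scalerBr ?scalerDr ?opprD addrACA.
Qed.

HB.instance Definition _ x :=
  GRing.isLinear.Build R (oct R) (oct R) _ (omul x) (omul_linear x).

(** Linearity of the left multiplication by e_i moves the sum over the
    coordinates of f inside the product. *)
Lemma octCR_omul (f : oct R -> oct R) x :
  octCR f x
  = \sum_(i < 8) omul (e i) (\row_j partial i (fun y => f y 0 j) x).
Proof.
apply: eq_bigr => i _.
rewrite [X in omul _ X]row_sum_delta linear_sum; apply: eq_bigr => j _.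
by rewrite linearZ /= mxE.
Qed.

Lemma sum8 (V : zmodType) (F : 'I_8 -> V) :
  \sum_i F i = (F 0 + F 1) + (F 2 + F 3) + (F 4 + F 5) + (F 6 + F 7).
Proof.
rewrite !big_ord_recl big_ord0 addr0 !addrA.
by do !congr (_ + _); congr F; apply: val_inj.
Qed.

(** The table omul_coct with a differential operator in the left factor. Here
    b_k i stands for the i-th partial derivative of f_k, so that d and dbar are
    the shapes of the operators d/dz and d/d(conj z). *)
Lemma sum_omul_e (b1 b2 b3 b4 : 'I_8 -> R[i]) :
  let d m n (b : 'I_8 -> R[i]) := b m + 'i%C * b n in
  let dbar m n (b : 'I_8 -> R[i]) := b m - 'i%C * b n in
  let cj (b : 'I_8 -> R[i]) i := conjc (b i) in
  \sum_i omul (e i) (coct (b1 i) (b2 i) (b3 i) (b4 i)) =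
  coct (d 0 1 b1 - d 2 3 (cj b2) - d 4 5 (cj b3) - dbar 6 7 b4)
       (d 0 1 b2 + d 2 3 (cj b1) + dbar 4 5 b4 - d 6 7 (cj b3))
       (d 0 1 b3 - dbar 2 3 b4 + d 4 5 (cj b1) + d 6 7 (cj b2))
       (dbar 0 1 b4 + d 2 3 b3 - d 4 5 b2 + d 6 7 b1).
Proof.
move=> d dbar cj.
have [[e0 e1] [e2 e3] [e4 e5] [e6 e7]] := e_coct.
have conji : conjc 'i%C = - 'i%C :> R[i].
  by apply/eqP; rewrite eq_complex /= oppr0 !eqxx.
rewrite sum8 e0 e1 e2 e3 e4 e5 e6 e7 !omul_coct !coctD.
rewrite !conji !rmorph0 !rmorph1 /d /dbar /cj.
by congr coct; ring.
Qed.

(** * Derivatives of the complex coordinates *)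

Lemma partial_near (n : 'I_8) (g h : oct R -> R) x :
  (\near x, g x = h x) -> partial n g x = partial n h x.
Proof. exact: near_eq_derive. Qed.

(** Only the imaginary part changes, by a sign. *)
Lemma partialC_conjf (n : 'I_8) (g : oct R -> R[i]) x :
  derivable (fun y => complex.Im (g y)) x (e n) ->
  partialC n (conjf g) x = conjc (partialC n g x).
Proof.
move=> dg; rewrite /partialC /conjf /=.
have <- : partial n (fun y => - complex.Im (g y)) x
          = - partial n (fun y => complex.Im (g y)) x.
  by rewrite /partial -deriveN.
by congr Complex; congr partial; apply/funext => y; case: (g y).
Qed.

End ComplexCoordinates.

Theorem mainTheorem2 (R : realType) (Omega : set (oct R))
    (f : oct R -> oct R) (f1 f2 f3 f4 : oct R -> R[i]) :
  open Omega ->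
  (forall x, Omega x ->
     forall j : 'I_8, differentiable (fun y : oct R => f y 0 j) x) ->
  (forall x, Omega x ->
     f x = octC (f1 x) + omul (octC (f2 x)) (e 2)
           + omul (octC (f3 x) + omul (octC (f4 x)) (e 2)) (e 4)) ->
  (forall x, Omega x -> octCR f x = 0) <->
  (forall x, Omega x ->
    [/\ dz1 f1 x - dz2 (conjf f2) x - dz3 (conjf f3) x - dzbar4 f4 x = 0,
        dz1 f2 x + dz2 (conjf f1) x + dzbar3 f4 x - dz4 (conjf f3) x = 0,
        dz1 f3 x - dzbar2 f4 x + dz3 (conjf f1) x + dz4 (conjf f2) x = 0
      & dzbar1 f4 x + dz2 f3 x - dz3 f2 x + dz4 f1 x = 0]).
Proof.
move=> oO df fE.
suff CRE x : Omega x -> octCR f x =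
  coct (dz1 f1 x - dz2 (conjf f2) x - dz3 (conjf f3) x - dzbar4 f4 x)
       (dz1 f2 x + dz2 (conjf f1) x + dzbar3 f4 x - dz4 (conjf f3) x)
       (dz1 f3 x - dzbar2 f4 x + dz3 (conjf f1) x + dz4 (conjf f2) x)
       (dzbar1 f4 x + dz2 f3 x - dz3 f2 x + dz4 f1 x).
  by split=> H x Ox; have := H x Ox; rewrite CRE // coct_eq0.
move=> Ox.
(* The real coordinates of f, as given by its complex coordinates: an identity
   that holds on Omega only, hence near x. *)
pose F y := [:: complex.Re (f1 y); complex.Im (f1 y);
                complex.Re (f2 y); complex.Im (f2 y);
                complex.Re (f3 y); complex.Im (f3 y);
                complex.Re (f4 y); complex.Im (f4 y)].
have fF (j : 'I_8) : \near x, f x 0 j = (F x)`_j.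
  near=> y; have Oy : Omega y by near: y; exact: open_nbhs_nbhs.
  by rewrite fE // octC_decomposition coctE mxE.
have dF (n j : 'I_8) : derivable (fun y => (F y)`_j) x (e n).
  exact: near_eq_derivable (fF j) (diff_derivable (df x Ox j)).
have conjE n : [/\ partialC n (conjf f1) x = conjc (partialC n f1 x),
                   partialC n (conjf f2) x = conjc (partialC n f2 x)
                 & partialC n (conjf f3) x = conjc (partialC n f3 x)].
  split; apply: partialC_conjf.
  - exact: dF n 1.
  - exact: dF n 3.
  - exact: dF n 5.
have rowE n : \row_j partial n (fun y => f y 0 j) x
    = coct (partialC n f1 x) (partialC n f2 x)
           (partialC n f3 x) (partialC n f4 x).
  rewrite coctE; apply/rowP => j; rewrite !mxE (partial_near n (fF j)).
  by case: j => [[|[|[|[|[|[|[|[|//]]]]]]]] lt8].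
rewrite octCR_omul (eq_bigr _ (fun n _ => congr1 (omul (e n)) (rowE n))).
rewrite sum_omul_e.
rewrite /dz1 /dz2 /dz3 /dz4 /dzbar1 /dzbar2 /dzbar3 /dzbar4 /dplus /dminus.
have [c21 c22 c23] := conjE 2; have [c31 c32 c33] := conjE 3.
have [c41 c42 c43] := conjE 4; have [c51 c52 c53] := conjE 5.
have [c61 c62 c63] := conjE 6; have [c71 c72 c73] := conjE 7.
by rewrite c21 c22 c31 c32 c41 c43 c51 c53 c62 c63 c72 c73.
Unshelve. all: by end_near.
Qed.
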